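(* Let $M\ge1$ be an integer, $\alpha_{\rm c}>0$, $p>0$, $\mathcal R_0>0$, and let $\mathbf h_{\rm c}\sim\mathcal{CN}(\mathbf 0,\alpha_{\rm c}\mathbf I)$ be a random vector in $\mathbb C^{M\times1}$. The outage probability of the communications-centric design, $\mathcal P_{\rm c}^{\rm c}=\Pr(\log_2(1+p\lVert\mathbf h_{\rm c}\rVert^2)<\mathcal R_0)$, is given by $$\mathcal P_{\rm c}^{\rm c}=\frac{1}{\Gamma(M)}\,\gamma\!\left(M,\frac{2^{\mathcal R_0}-1}{p\alpha_{\rm c}}\right).$$ Moreover, as $p\to\infty$, $$\mathcal P_{\rm c}^{\rm c}\approx\frac{(2^{\mathcal R_0}-1)^M}{p^M\alpha_{\rm c}^M\,M!}.$$
   Context: A base station with $M$ transmit antennas sends $\sqrt p\,\mathbf w\mathbf s^{\mathsf H}$ with power budget $p$ and unit-norm beamformer $\mathbf w\in\mathbb C^{M\times1}$; a single-antenna user with channel $\mathbf h_{\rm c}$ (known to the base station) and unit-variance Gaussian noise attains the communication rate $\log_2(1+p|\mathbf w^{\mathsf H}\mathbf h_{\rm c}|^2)$. The communications-centric design uses the rate-maximizing beamformer $\mathbf w_{\rm c}=\mathbf h_{\rm c}/\lVert\mathbf h_{\rm c}\rVert$, so its instantaneous rate is $\log_2(1+p\lVert\mathbf h_{\rm c}\rVert^2)$. $\mathcal R_0$ is the target communication rate. $\mathcal{CN}(\mathbf 0,\alpha_{\rm c}\mathbf I)$ is the circularly symmetric complex Gaussian law: i.i.d. entries with mean zero and variance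 $\mathbb E|\cdot|^2=\alpha_{\rm c}$. $\gamma(s,x)=\int_0^x t^{s-1}e^{-t}\,dt$ is the lower incomplete gamma function and $\Gamma$ the gamma function. For outage probabilities, ''$\approx$ as $p\to\infty$'' means that the ratio of the two sides tends to $1$. *)

(* Defs.v *)
From mathcomp Require Import all_boot all_order all_algebra.
From mathcomp Require Import all_classical all_reals all_analysis.
From mathcomp Require Import complex.
Import Order.TTheory GRing.Theory Num.Theory.
Import numFieldNormedType.Exports.

Set Implicit Arguments.
Unset Strict Implicit.
Unset Printing Implicit Defensive.

Local Open Scope classical_set_scope.
Local Open Scope ring_scope.

Definition mutually_independent d d' (T : measurableType d)
    (U : measurableType d') (R : realType) (P : probability T R)
    (I : finType) (X : I -> T -> U) : Prop :=
  forall (J : {set I}) (B : I -> set U), (forall i, measurable (B i)) ->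
    P (\bigcap_(i in [set` J]) (X i @^-1` B i)) =
    (\prod_(i in J) P (X i @^-1` B i))%E.

(* R[i] carries no sigma-algebra in the libraries: a complex random variable is
   handled through its real and imaginary parts, with the Borel sigma-algebra
   of the product R * R. *)
Definition Re_Im (R : realType) (z : R[i]) : R * R :=
  (complex.Re z, complex.Im z).

(* The law CN(0, a) on the plane: independent real and imaginary parts, each
   N(0, a / 2), so that E|z|^2 = a. The second parameter of [normal_prob] is the
   standard deviation. *)
Definition complex_normal_prob (R : realType) (a : R) : set (R * R) -> \bar R :=
  (normal_prob 0 (Num.sqrt (a / 2)) \x normal_prob 0 (Num.sqrt (a / 2)))%E.

(* h ~ CN(0, a I): i.i.d. CN(0, a) entries, independence being that of the
   planar variables (Re, Im) of the M entries. *)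
Definition complex_normal_vector d (T : measurableType d) (R : realType)
    (P : probability T R) (M : nat) (a : R) (h : T -> 'cV[R[i]]_M) : Prop :=
  let X (i : 'I_M) (t : T) : R * R := Re_Im (h t i ord0) in
  [/\ forall i, measurable_fun setT (X i),
      mutually_independent P X &
      forall i (A : set (R * R)), measurable A ->
        pushforward P (X i) A = complex_normal_prob a A].

Definition cvec_norm (R : realType) (M : nat) (v : 'cV[R[i]]_M) : R :=
  Num.sqrt (\sum_(i < M) Normc.normc (v i ord0) ^+ 2).

Definition log2 (R : realType) (x : R) : R := ln x / ln 2.

(* With w = h / |h| the gain |w^H h|^2 equals |h|^2. *)
Definition comm_rate (R : realType) (M : nat) (p : R) (h : 'cV[R[i]]_M) : R :=
  log2 (1 + p * cvec_norm h ^+ 2).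

Definition outage_prob d (T : measurableType d) (R : realType)
    (P : probability T R) (M : nat) (h : T -> 'cV[R[i]]_M) (R0 p : R) : \bar R :=
  P [set t | comm_rate p (h t) < R0].

Definition Gamma (R : realType) (s : R) : R :=
  \int[lebesgue_measure]_(t in `[0%R, +oo[) (t `^ (s - 1) * expR (- t)).

Definition lower_gamma (R : realType) (s x : R) : R :=
  \int[lebesgue_measure]_(t in `[0%R, x]) (t `^ (s - 1) * expR (- t)).

(* Main.v *)
(* Up to the factor alpha, the squared moduli |h_i|^2 are independent standard
   exponential variables, so |h|^2 / alpha follows the Erlang law with M stages,
   whose distribution function is 1 - e^(-x) (1 + x + ... + x^(M-1) / (M-1)!).

   Exponential law: the planar Lebesgue measure of a disc is a constant times
   the squared radius, by scaling alone. The image of planar Lebesgue measure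
   under z |-> |z|^2 / alpha is therefore a constant times Lebesgue measure on
   [0, +oo[, and the Gaussian density becomes proportional to e^(-x); the
   constant (in which pi disappears) is fixed by the total mass being 1, so
   that no polar coordinates are needed.

   Erlang law: a sum over a set K of indices is independent of any cylinder
   event over indices outside K, which gives the convolution formula adding one
   index to K; the resulting integral has an explicit antiderivative.

   Asymptotics: e^(-x) <= e^(-t) <= 1 on [0, x] squeezes the ratio between
   e^(-x) and 1 for x = (2^R0 - 1) / (p alpha), which tends to 0. *)
Require Import Defs.
From HB Require Import structures.
From mathcomp Require Import all_boot all_order all_algebra.
From mathcomp Require Import all_classical all_reals all_analysis.
From mathcomp Require Import measurable_realfun.
From mathcomp Require Import complex.
From mathcomp Require Import ring.
Import Order.TTheory GRing.Theory Num.Theory.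
Import numFieldNormedType.Exports.
Local Open Scope classical_set_scope.
Local Open Scope ring_scope.

Set Implicit Arguments.
Unset Strict Implicit.
Unset Printing Implicit Defensive.

(** * Densities and images of Lebesgue measure *)

Section integral_density.
Import HBNNSimple.

(** Monotone convergence along simple approximations of [g] reduces the formula to indicators, where
    it is the hypothesis on [m]. It serves for the normal law, for the image of planar Lebesgue
    measure and for the law of a summand in a convolution. *)
Lemma ge0_integral_density d (T : measurableType d) (R : realType)
    (m mu : {measure set T -> \bar R}) (f : T -> R) (g : T -> \bar R) :
  measurable_fun setT f -> (forall x, 0 <= f x) ->
  (forall A, measurable A -> m A = (\int[mu]_(x in A) (f x)%:E)%E) ->
  measurable_fun setT g -> (forall x, 0 <= g x)%E ->
  (\int[m]_x g x = \int[mu]_x (g x * (f x)%:E))%E.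
Proof.
move=> mf f0 mE mg g0.
pose h := nnsfun_approx measurableT mg.
have hg x : (h n x)%:E @[n --> \oo] --> g x by exact: cvg_nnsfun_approx.
have ndh x : {homo (fun n => (h n x)%:E) : a b / (a <= b)%N >-> (a <= b)%E}.
  by move=> a b ab; rewrite lee_fin; exact/lefP/nd_nnsfun_approx.
have mh n : measurable_fun setT (fun x => (h n x)%:E) by exact/measurable_EFinP.
have mfE : measurable_fun setT (fun x => (f x)%:E) by exact/measurable_EFinP.
transitivity (limn (fun n => \int[m]_x (h n x)%:E))%E.
  rewrite -monotone_convergence//.
  - by apply: eq_integral => x _; apply/esym/cvg_lim => //; exact: hg.
  - by move=> n x _; rewrite lee_fin.
transitivity (limn (fun n => \int[mu]_x ((h n x)%:E * (f x)%:E)))%E; last first.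
  rewrite -monotone_convergence//.
  - apply: eq_integral => x _; apply/cvg_lim => //.
    by apply: cvgeZr => //; exact: hg.
  - by move=> n; exact: emeasurable_funM.
  - by move=> n x _; apply: mule_ge0; rewrite lee_fin.
  - by move=> x _ a b ab; rewrite lee_wpmul2r ?lee_fin//; exact: ndh.
congr (limn _); apply/funext => n.
under eq_integral do rewrite fimfunE -fsumEFin//.
under [RHS]eq_integral => x _.
  rewrite fimfunE -fsumEFin// ge0_mule_fsuml; last first.
    by move=> r; rewrite EFinM nnfun_muleindic_ge0.
  over.
have mind r : measurable_fun setT (fun x => (r * \1_(h n @^-1` [set r]) x)%:E).
  by apply/measurable_EFinP; exact: measurable_funM.
rewrite !ge0_integral_fsum//; last 3 first.
- by move=> r; apply: emeasurable_funM.
- by move=> r x _; rewrite mule_ge0 ?lee_fin// -lee_fin EFinM nnfun_muleindic_ge0.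
- by move=> r x _; rewrite EFinM nnfun_muleindic_ge0.
(* Only values attained by [h n] occur in the sum, so the coefficient is nonnegative and can be
   moved through the integral. *)
apply: eq_fsbigr => r /[!inE] -[t _ <-].
rewrite integralZl_indic_nnsfun// integral_indic// setIT mE//.
rewrite [X in (_ * X)%E]integral_mkcond -ge0_integralZl//.
- apply: eq_integral => x _; rewrite patchE indicE.
  by case: ifPn => _; rewrite ?mulr1 ?mulr0 ?mul0e ?mule0.
- by apply/measurable_restrict => //; exact: measurable_funTS.
- by move=> x _; rewrite patchE; case: ifP; rewrite ?lee_fin.
- by rewrite lee_fin.
Qed.

End integral_density.

(* The measure structure of [pushforward m f] takes the measurability of [f] as
   an argument that unification cannot find, hence this packed version. *)
Definition image_measure d1 d2 (T1 : measurableType d1)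
    (T2 : measurableType d2) (R : realType) (m : {measure set T1 -> \bar R})
    (f : T1 -> T2) (mf : measurable_fun setT f) : {measure set T2 -> \bar R}.
Proof. by refine (pushforward m f : measure _ _); exact: mf. Defined.

(** The image of Lebesgue measure under multiplication by [s], weighted by [s], gives every
    half-open interval its length, hence is Lebesgue measure; what remains is integration against an
    image measure. *)
Lemma ge0_integral_lebesgue_scale (R : realType) (s : R) (f : R -> \bar R) :
  0 < s -> measurable_fun setT f -> (forall x, 0 <= f x)%E ->
  (\int[lebesgue_measure]_x f x =
   s%:E * \int[lebesgue_measure]_x f (s * x)%R)%E.
Proof.
move=> s0 mf f0.
have ms : measurable_fun setT ( *%R s : measurableTypeR R -> measurableTypeR R).
  exact: measurable_funM.
pose m' := mscale (NngNum (ltW s0)) (image_measure lebesgue_measure ms).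
have -> : (\int[lebesgue_measure]_x f x = \int[m']_x f x)%E.
  apply: eq_measure_integral => A mA _.
  apply: lebesgue_measure_unique => // _ [[a b]] _ <-.
  rewrite -[RHS]/(s%:E * lebesgue_measure ( *%R s @^-1` `]a, b]))%E /=.
  have -> : *%R s @^-1` `]a, b] = `]s^-1 * a, s^-1 * b]%classic.
    by apply/seteqP; split => x /=; rewrite !in_itv/= ltr_pdivrMl// ler_pdivlMl.
  rewrite !lebesgue_measure_itv/= !lte_fin ltr_pM2l ?invr_gt0//.
  case: ifPn => _; rewrite ?mule0// -EFinD -EFinM -mulrBr mulrA divff ?mul1r//.
  by rewrite gt_eqF.
rewrite ge0_integral_mscale//.
by rewrite ge0_integral_pushforward.
Qed.

Lemma lebesgue_measure_preimage_scale (R : realType) (s : R) (A : set R) :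
  0 < s -> measurable A ->
  (lebesgue_measure A = s%:E * lebesgue_measure ( *%R s @^-1` A))%E.
Proof.
move=> s0 mA.
have ms : measurable ( *%R s @^-1` A).
  have ms : measurable_fun setT ( *%R s : R -> R) by exact: measurable_funM.
  by rewrite -[X in measurable X]setTI; exact: ms.
rewrite -[in LHS](setIT A) -integral_indic// (ge0_integral_lebesgue_scale s0)//.
- by congr (_ * _)%E; rewrite -[in RHS](setIT (_ @^-1` _)) -[in RHS]integral_indic.
- exact/measurable_EFinP.
Qed.

Definition sqnorm2 (R : realType) (z : R * R) : R := z.1 ^+ 2 + z.2 ^+ 2.

Lemma measurable_sqnorm2 (R : realType) : measurable_fun setT (@sqnorm2 R).
Proof. by apply: measurable_funD; apply: measurable_funX. Qed.

Lemma sqnorm2_ge0 (R : realType) (z : R * R) : 0 <= sqnorm2 z.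
Proof. by rewrite addr_ge0 ?sqr_ge0. Qed.

(** The parameter is the squared radius, so that the area is linear in it. *)
Definition disc (R : realType) (r : R) : set (R * R) :=
  [set z | sqnorm2 z < r].

Lemma measurable_disc (R : realType) (r : R) : measurable (disc r).
Proof.
rewrite (_ : disc r = @sqnorm2 R @^-1` `]-oo, r[%classic).
  by rewrite -[X in measurable X]setTI; exact: measurable_sqnorm2.
by apply/seteqP; split => z /=; rewrite in_itv.
Qed.

(* [measurableTypeR R] and [R] carry the same Borel sets but different displays;
   [lebesgue_measure] lives on the former. *)
Definition planar_lebesgue (R : realType) :
    {measure set (measurableTypeR R * measurableTypeR R) -> \bar R} :=
  (@lebesgue_measure R \x @lebesgue_measure R)%E.

(** The dilation by [s], with [s ^+ 2 = r], is applied to one axis at a time: the outer integral and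
    the lengths of the sections contribute one factor [s] each. *)
Lemma planar_lebesgue_disc (R : realType) (r : R) : 0 < r ->
  planar_lebesgue R (disc r) = (r%:E * planar_lebesgue R (disc 1))%E.
Proof.
move=> r0; pose s := Num.sqrt r.
have s0 : 0 < s by rewrite sqrtr_gt0.
have s2 : s ^+ 2 = r by rewrite sqr_sqrtr ?ltW.
have mxD (t x : R) : measurable (xsection (disc t) x).
  by apply: measurable_xsection; exact: measurable_disc.
have mF (t : R) : measurable_fun setT (lebesgue_measure \o xsection (disc t)).
  by apply: measurable_fun_xsection; exact: measurable_disc.
rewrite /planar_lebesgue /= /product_measure1.
rewrite (ge0_integral_lebesgue_scale s0)//.
have E x : lebesgue_measure (xsection (disc r) (s * x)) =
    (s%:E * lebesgue_measure (xsection (disc 1) x))%E.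
  rewrite (lebesgue_measure_preimage_scale s0)//.
  congr (_ * lebesgue_measure _)%E.
  apply/seteqP; split => y /=; rewrite /xsection /= !inE /disc/= /sqnorm2/=.
    by rewrite !exprMn s2 -mulrDr -[X in _ < X](mulr1 r) ltr_pM2l.
  by rewrite !exprMn s2 -mulrDr -[X in _ -> _ < X](mulr1 r) ltr_pM2l.
under eq_integral do rewrite /= E.
rewrite ge0_integralZl//.
- by rewrite muleA -EFinM -expr2 s2.
- exact: mF.
- by rewrite lee_fin ltW.
Qed.

(** The unit disc lies in the square [-1, 1]^2. Finiteness makes its area a real constant and
    provides the exhaustion by sets of finite measure that uniqueness of measures requires. *)
Lemma planar_lebesgue_disc_lty (R : realType) (r : R) :
  (planar_lebesgue R (disc r) < +oo)%E.
Proof.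
have [r0|r0] := leP r 0.
  rewrite (_ : disc r = set0) ?measure0//.
  apply/seteqP; split => // z /=; rewrite /disc/= => /lt_le_trans => /(_ _ r0).
  by rewrite ltNge sqnorm2_ge0.
rewrite planar_lebesgue_disc// lte_mul_pinfty ?lee_fin ?ltW//.
pose I := `[-1, 1]%classic : set R.
apply: (@le_lt_trans _ _ (planar_lebesgue R (I `*` I))).
  apply: le_measure; rewrite ?inE//.
  - exact: measurable_disc.
  - by apply: measurableX; exact: measurable_itv.
  move=> [x y]; rewrite /disc/= /sqnorm2/= /I/= !in_itv/= -!ler_norml => xy1.
  have sq_le1 (t : R) : t ^+ 2 <= 1 -> `|t| <= 1.
    by rewrite -[in X in X -> _]real_normK ?num_real// expr_le1.
  by split; apply: sq_le1; apply: le_trans (ltW xy1);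
    rewrite ?lerDl ?lerDr sqr_ge0.
rewrite [ltLHS]product_measure1E/= ; [|exact: measurable_itv..].
by rewrite lebesgue_measure_itv/=; case: ifP => _; rewrite ?mule0 -?EFinD -?EFinM ltry.
Qed.

(** The constant is [a] times the area of the unit disc. Half-lines []-oo, v[] generate the Borel
    sets and are stable under intersection, and their preimages are discs, so agreement of the two
    measures on them suffices. *)
Lemma planar_lebesgue_sqnorm2 (R : realType) (a : R) : 0 < a ->
  exists2 K : R, 0 <= K & forall B : set R, measurable B ->
    planar_lebesgue R ((fun z => sqnorm2 z / a) @^-1` B) =
    (K%:E * lebesgue_measure (B `&` `[0%R, +oo[))%E.
Proof.
move=> a0.
have mu : measurable_fun setT
    ((fun z => sqnorm2 z / a) :
      measurableTypeR R * measurableTypeR R -> measurableTypeR R).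
  by apply: measurable_funM => //; exact: measurable_sqnorm2.
have uE v : (fun z => sqnorm2 z / a) @^-1` `]-oo, v[ = disc (a * v).
  by apply/seteqP; split => z /=; rewrite in_itv/= ltr_pdivrMr// mulrC.
pose A1 := fine (planar_lebesgue R (disc 1)).
have A1_fin : planar_lebesgue R (disc 1) = A1%:E.
  by rewrite /A1 fineK// ge0_fin_numE// planar_lebesgue_disc_lty.
have A10 : 0 <= A1 by rewrite -lee_fin -A1_fin.
have aA1 : 0 <= a * A1 by rewrite mulr_ge0// ltW.
exists (a * A1) => // B mB.
pose m1 := image_measure (planar_lebesgue R) mu.
pose m2 := mscale (NngNum aA1) (mrestr lebesgue_measure (measurable_itv `[0%R:R, +oo[)).
rewrite -[LHS]/(m1 B) -[RHS]/(m2 B).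
apply: (@measure_unique _ R (measurableTypeR R) (@RGenInftyO.G R)
  (fun n => `]-oo, n%:R[%classic) _ _ _ _ m1 m2) => //.
- exact: RGenInftyO.measurableE.
- move=> _ _ [x ->] [y ->]; exists (Num.min x y).
  by apply/seteqP; split => z /=; rewrite !in_itv/= lt_min => /andP.
- by move=> n; exists n%:R.
- apply/seteqP; split => // x _; exists (Num.bound `|x|) => //=.
  by rewrite in_itv/= (le_lt_trans (ler_norm x))// archi_boundP.
- move=> _ [v ->].
  rewrite -[LHS]/(planar_lebesgue R ((fun z => sqnorm2 z / a) @^-1` `]-oo, v[)).
  rewrite -[RHS]/((a * A1)%:E * lebesgue_measure (`]-oo, v[ `&` `[0%R, +oo[))%E.
  (* For [v <= 0] both sets are empty; otherwise the area is linear in [a * v]. *)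
  rewrite uE; have [v0|v0] := leP v 0.
    rewrite (_ : _ `&` _ = set0) ?measure0 ?mule0; last first.
      apply/seteqP; split => // x [] /=; rewrite !in_itv/= andbT => xv x0.
      by have := lt_le_trans xv v0; rewrite ltNge x0.
    rewrite (_ : disc _ = set0) ?measure0//.
    apply/seteqP; split => // z; rewrite /disc/= => zav.
    have : a * v <= 0 by rewrite pmulr_rle0.
    by rewrite leNgt (le_lt_trans (sqnorm2_ge0 z) zav).
  rewrite planar_lebesgue_disc ?mulr_gt0// A1_fin.
  rewrite (_ : _ `&` _ = `[0, v[%classic); last first.
    by apply/seteqP; split => x /=; rewrite !in_itv/= andbT andbC => /andP.
  rewrite lebesgue_measure_itv/= lte_fin v0 oppr0 adde0 -!EFinM.
  by congr EFin; rewrite mulrAC.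
- move=> n.
  rewrite -[ltLHS]/(planar_lebesgue R ((fun z => sqnorm2 z / a) @^-1` `]-oo, n%:R[)).
  by rewrite uE planar_lebesgue_disc_lty.
Qed.

(** * The squared modulus of a complex normal variable *)

Lemma complex_normal_prob_density (R : realType) (a : R) (A : set (R * R)) :
  0 < a -> measurable A ->
  complex_normal_prob a A =
    (\int[planar_lebesgue R]_z
      (\1_A z * (normal_peak (Num.sqrt (a / 2)) ^+ 2 * expR (- (sqnorm2 z / a))))%:E)%E.
Proof.
move=> a0 mA; set s := Num.sqrt (a / 2).
have a20 : 0 < a / 2 by rewrite divr_gt0.
have s0 : s != 0 by rewrite gt_eqF// sqrtr_gt0.
have s2 : s ^+ 2 = a / 2 by rewrite sqr_sqrtr ?ltW.
pose phi := normal_pdf 0 s.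
have phi0 x : 0 <= phi x by exact: normal_pdf_ge0.
have mphi : measurable_fun setT phi by exact: measurable_normal_pdf.
(* Since [2 * s ^+ 2 = a], the product of the two densities depends on the squared modulus alone. *)
have phiM x y : phi x * phi y = normal_peak s ^+ 2 * expR (- (sqnorm2 (x, y) / a)).
  rewrite /phi normal_pdfE// /normal_fun mulrACA -expr2 -expRD; congr (_ * expR _).
  rewrite /sqnorm2/= !subr0 s2 -mulr_natr divfK// !mulNr -opprD.
  by rewrite -mulrDl.
have mxA x : measurable (xsection A x) by exact: measurable_xsection.
pose f (z : R * R) := (\1_A z * (phi z.1 * phi z.2))%:E.
have mf : measurable_fun setT (f : measurableTypeR R * measurableTypeR R -> \bar R).
  apply/measurable_EFinP; apply: measurable_funM; first exact: measurable_indic.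
  by apply: measurable_funM; exact: measurableT_comp.
have f0 z : (0 <= f z)%E by rewrite lee_fin !mulr_ge0.
transitivity (\int[planar_lebesgue R]_z f z)%E; last first.
  by apply: eq_integral => -[x y] _; rewrite /f phiM.
rewrite fubini_tonelli1//.
rewrite /complex_normal_prob /product_measure1.
rewrite (@ge0_integral_density _ (measurableTypeR R) R (normal_prob 0 s)
  lebesgue_measure phi)//; last first.
  exact: measurable_fun_xsection.
apply: eq_integral => x _.
rewrite /fubini_F /= muleC /normal_prob integral_mkcond -ge0_integralZl//.
- apply: eq_integral => y _; rewrite patchE /f indicE mem_xsection.
  by case: ifPn => _; rewrite ?mule0 ?mul0r ?mul1r.
- apply/measurable_restrict => //; first exact: mxA.
  by apply: measurable_funTS; exact/measurable_EFinP.
- by move=> y _; rewrite patchE; case: ifP; rewrite ?lee_fin.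
- by rewrite lee_fin.
Qed.

Lemma complex_normal_prob_sqnorm2 (R : realType) (a : R) (B : set R) :
  0 < a -> measurable B ->
  complex_normal_prob a ((fun z => sqnorm2 z / a) @^-1` B) =
    (\int[lebesgue_measure]_(x in B) (exponential_pdf 1 x)%:E)%E.
Proof.
move=> a0; have [K K0 uK] := planar_lebesgue_sqnorm2 a0.
pose u (z : measurableTypeR R * measurableTypeR R) : measurableTypeR R := sqnorm2 z / a.
have mu : measurable_fun setT u.
  by apply: measurable_funM => //; exact: measurable_sqnorm2.
pose C := normal_peak (Num.sqrt (a / 2)) ^+ 2.
have C0 : 0 <= C by rewrite sqr_ge0.
have main (E : set R) : measurable E -> complex_normal_prob a (u @^-1` E) =
    ((C * K)%:E * \int[lebesgue_measure]_(x in E) (exponential_pdf 1 x)%:E)%E.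
  move=> mE.
  have muE : measurable (u @^-1` E).
    by rewrite -[X in measurable X]setTI; exact: mu.
  rewrite complex_normal_prob_density// -/C.
  pose g (w : measurableTypeR R) := (\1_E w * (C * expR (- w)))%:E.
  have mg : measurable_fun setT g.
    apply/measurable_EFinP/measurable_funM; first exact: measurable_indic.
    by apply: measurable_funM => //; exact: measurableT_comp.
  have g0 w : (0 <= g w)%E.
    rewrite lee_fin; apply: mulr_ge0; first by rewrite indicE.
    by rewrite mulr_ge0 ?expR_ge0.
  transitivity (\int[image_measure (planar_lebesgue R) mu]_w g w)%E.
    by rewrite ge0_integral_pushforward.
  (* By [uK], the image measure has the constant density [K] on [[0, +oo[]. *)
  rewrite (@ge0_integral_density _ (measurableTypeR R) R _ lebesgue_measure
    (fun w => K * \1_`[0, +oo[ w))//.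
  - rewrite [in RHS]integral_mkcond -ge0_integralZl//.
    + apply: eq_integral => w _; rewrite patchE /g /exponential_pdf patchE !indicE.
      case: ifPn => [_|_]; last by rewrite mul0r mule0 mul0e.
      case: ifPn => [_|_]; last by rewrite !mulr0 !mule0.
      by rewrite -!EFinM !mulr1 !mul1r mulN1r mulrAC.
    + apply/measurable_restrict => //.
      apply: measurable_funTS; apply/measurable_EFinP.
      exact: measurable_exponential_pdf.
    + by move=> w _; rewrite patchE; case: ifP; rewrite ?lee_fin// exponential_pdf_ge0.
    + by rewrite lee_fin mulr_ge0.
  - by apply: measurable_funM => //; exact: measurable_indic.
  - by move=> w; rewrite mulr_ge0.
  - move=> D mD; rewrite [LHS](uK D mD).
    under eq_integral do rewrite EFinM.
    rewrite ge0_integralZl//; last first.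
      by apply/measurable_EFinP; exact: measurable_indic.
    by rewrite integral_indic// setIC.
(* The whole plane determines the product [C * K], because the planar normal law and the exponential
   law both have mass 1. *)
have CK : 1%E = (C * K)%:E.
  have <- : complex_normal_prob a setT = 1%E.
    rewrite /complex_normal_prob -setXTT product_measure1E//=.
    by rewrite /normal_prob integral_normal_pdf mule1.
  by rewrite -(preimage_setT u) main// integral_exponential_pdf// mule1.
by move=> mB; rewrite [LHS]main// -CK mul1e.
Qed.

(** * Sums of independent variables *)

(** Conditionally on [E], the pair follows the product of its marginal laws: this holds on
    rectangles by hypothesis, and a product measure is determined by its rectangles. *)
Lemma independent_pair_law d (T : measurableType d) (R : realType)
    (P : probability T R) (X Y : {mfun T >-> measurableTypeR R}) (E : set T) :
  measurable E ->
  (forall A B : set (measurableTypeR R), measurable A -> measurable B ->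
    P ((X @^-1` A `&` Y @^-1` B) `&` E) =
    (P (X @^-1` A) * P (Y @^-1` B) * P E)%E) ->
  forall C : set (measurableTypeR R * measurableTypeR R), measurable C ->
    P ((fun t => (X t, Y t)) @^-1` C `&` E) =
    ((distribution P X \x distribution P Y) C * P E)%E.
Proof.
move=> mE XYE C mC.
have mXY : measurable_fun setT (fun t => (X t, Y t)) by exact: measurable_fun_pair.
have mXYC : measurable ((fun t => (X t, Y t)) @^-1` C).
  by rewrite -[Z in measurable Z]setTI; exact: mXY.
have PE_fin : P E \is a fin_num by exact: fin_num_measure.
(* Conditioning divides by [P E]; when it is zero, both sides vanish. *)
have [PE0|PE0] := eqVneq (P E) 0%E.
  rewrite PE0 mule0; apply: (@subset_measure0 _ _ _ P _ E) => //.
  exact: measurableI.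
have PE_gt0 : 0 < fine (P E).
  by rewrite lt_neqAle eq_sym fine_eq0// PE0 fine_ge0.
have PEV_ge0 : 0 <= (fine (P E))^-1 by rewrite invr_ge0 ltW.
pose m := mscale (NngNum PEV_ge0) (image_measure (mrestr P mE) mXY).
have mE' D : m D = ((fine (P E))^-1%:E * P ((fun t => (X t, Y t)) @^-1` D `&` E))%E.
  by [].
have -> : (distribution P X \x distribution P Y)%E C = m C.
  apply: product_measure_unique => // A B mA mB.
  rewrite -[LHS]/((fine (P E))^-1%:E * P ((X @^-1` A `&` Y @^-1` B) `&` E))%E.
  rewrite XYE// muleC -muleA -[X in (_ * (X * _))%E]fineK// -EFinM mulfV ?gt_eqF//.
  by rewrite mule1.
by rewrite mE' muleAC -[X in (_ * X * _)%E]fineK// -EFinM mulVf ?gt_eqF// mul1e.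
Qed.

Section sum_of_independent.
Context d d' (T : measurableType d) (U : measurableType d') (R : realType).
Variables (P : probability T R) (I : finType) (X : I -> T -> U) (f : U -> R).
Hypothesis mX : forall i, measurable_fun setT (X i).
Hypothesis mf : measurable_fun setT f.
Hypothesis XI : mutually_independent P X.

Definition partial_sum (K : {set I}) (t : T) : R := \sum_(i in K) f (X i t).

Lemma measurable_partial_sum (K : {set I}) : measurable_fun setT (partial_sum K).
Proof.
rewrite (_ : partial_sum K = fun t => \sum_i (if i \in K then f (X i t) else 0)).
  apply: measurable_sum => i; case: (i \in K) => //.
  exact: measurableT_comp.
by apply/funext => t; rewrite /partial_sum big_mkcond.
Qed.

Let mS (K : {set I}) :
  measurable_fun setT (partial_sum K : T -> measurableTypeR R).
Proof. exact: measurable_partial_sum. Qed.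
Let mY i : measurable_fun setT (f \o X i : T -> measurableTypeR R).
Proof. exact: measurableT_comp. Qed.

(** [distribution] expects bundled measurable functions, hence the packing of the partial sums and
    of the single summands. *)
Let S K : {mfun T >-> measurableTypeR R} :=
  HB.pack (partial_sum K : T -> measurableTypeR R)
    (isMeasurableFun.Build _ _ _ _ _ (mS K)).
Let Y i : {mfun T >-> measurableTypeR R} :=
  HB.pack (f \o X i : T -> measurableTypeR R)
    (isMeasurableFun.Build _ _ _ _ _ (mY i)).

Let cylinder (J : {set I}) (B : I -> set U) := \bigcap_(i in [set` J]) (X i @^-1` B i).

Let measurable_cylinder J B : (forall i, measurable (B i)) -> measurable (cylinder J B).
Proof.
move=> mB; apply: fin_bigcap_measurable => // i _.
by rewrite -[Z in measurable Z]setTI; exact: mX.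
Qed.

Let partial_sum_setU1 i (K : {set I}) : i \notin K ->
  partial_sum (i |: K) = (fun t => Y i t + S K t).
Proof. by move=> iK; apply/funext => t; rewrite /partial_sum big_setU1. Qed.

(** An event on a single summand is absorbed as one more coordinate of the cylinder; overwriting [B]
    at [i] is harmless because [i] lies outside [J]. *)
Let cylinder_setU1 i (J : {set I}) B (A : set R) : i \notin J ->
  cylinder (i |: J) (fun j => if j == i then f @^-1` A else B j) =
  Y i @^-1` A `&` cylinder J B.
Proof.
move=> iJ; apply/seteqP; split=> [t Ht|t [Ait Bt] j /=].
  split=> [|j jJ]; first by have := Ht i; rewrite /= setU11 eqxx; exact.
  have := Ht j; rewrite /= in_setU1 (_ : j \in J)// orbT.
  case: eqP => [ji _|_]; last exact.
  by move: iJ; rewrite -ji (_ : j \in J).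
by rewrite in_setU1; case: eqP => [-> _ //|_ /= jJ]; exact: Bt.
Qed.

Let cylinder_prob i (J : {set I}) B (A : set R) : i \notin J ->
  (forall j, measurable (B j)) -> measurable A ->
  P (Y i @^-1` A `&` cylinder J B) = (P (Y i @^-1` A) * P (cylinder J B))%E.
Proof.
move=> iJ mB mA; rewrite -cylinder_setU1// /cylinder !XI//; last first.
  move=> j; case: ifP => // _; rewrite -[Z in measurable Z]setTI; exact: mf.
rewrite big_setU1//= eqxx; congr (_ * _)%E.
apply: eq_bigr => j jJ; rewrite ifF//; apply/negbTE.
by apply: contra iJ => /eqP <-.
Qed.

Let sum_pair (A : set R) :=
  [set z : measurableTypeR R * measurableTypeR R | A (z.1 + z.2)].

Let measurable_sum_pair A : measurable A -> measurable (sum_pair A).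
Proof.
move=> mA; have madd : measurable_fun setT
    (fun z : measurableTypeR R * measurableTypeR R => (z.1 + z.2 : measurableTypeR R)).
  exact: measurable_funD.
by have := madd measurableT A mA; rewrite setTI.
Qed.

(** Independence of the shorter sum from the larger cylinder is left as a premise, so that the
    result can be used inside the induction proving that independence and again afterwards for the
    convolution formula. *)
Let partial_sum_setU1_law i (K J : {set I}) B (A : set R) :
  i \notin K -> i \notin J -> (forall j, measurable (B j)) -> measurable A ->
  (forall B' (D : set R), (forall j, measurable (B' j)) -> measurable D ->
    P (partial_sum K @^-1` D `&` cylinder (i |: J) B') =
    (P (partial_sum K @^-1` D) * P (cylinder (i |: J) B'))%E) ->
  P (partial_sum (i |: K) @^-1` A `&` cylinder J B) =
  ((distribution P (Y i) \x distribution P (S K)) (sum_pair A) * P (cylinder J B))%E.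
Proof.
move=> iK iJ mB mA KJ; rewrite partial_sum_setU1//.
rewrite -independent_pair_law//;
  [exact: measurable_cylinder| |exact: measurable_sum_pair].
move=> C D mC mD.
rewrite setIAC setIC -cylinder_setU1// KJ//; last first.
  by move=> j; case: ifP => // _; rewrite -[Z in measurable Z]setTI; exact: mf.
by rewrite cylinder_setU1// cylinder_prob// muleCA muleA.
Qed.

(** Induction on the size of [K]: one index moves from the sum into the cylinder, which is why the
    statement ranges over all [J] disjoint from [K]. *)
Lemma partial_sum_independent (K J : {set I}) B (A : set R) : K \subset ~: J ->
  (forall i, measurable (B i)) -> measurable A ->
  P (partial_sum K @^-1` A `&` cylinder J B) =
  (P (partial_sum K @^-1` A) * P (cylinder J B))%E.
Proof.
have [n] := ubnP #|K|; elim: n K J B A => // n IH K J B A Kn KJ mB mA.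
have [K0|[i iK]] := set_0Vmem K.
  have -> : partial_sum K = cst 0.
    by apply/funext => t; rewrite /partial_sum K0 big_set0.
  rewrite preimage_cst; case: ifP => _; first by rewrite setTI probability_setT mul1e.
  by rewrite set0I measure0 mul0e.
have iJ : i \notin J by have := fintype.subsetP KJ i iK; rewrite inE.
have iK' : i \notin K :\ i by rewrite setD11.
have mB0 (j : I) : measurable ((fun=> setT) j : set U) by [].
rewrite -(finset.setD1K iK).
have -> := partial_sum_setU1_law iK' iJ mB mA _; last first.
  move=> B' D mB' mD; apply: IH => //.
    by rewrite (cardsD1 i) iK in Kn.
  apply/fintype.subsetP => j; rewrite !inE => /andP[ji jK].
  by rewrite (negbTE ji)/=; have := fintype.subsetP KJ j jK; rewrite inE.
(* With an empty index set the cylinder is the whole space, and the same formula identifies the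
   product measure with the law of the sum. *)
congr (_ * _)%E.
have c0 : cylinder (@finset.set0 I) (fun=> setT) = setT.
  by apply/seteqP; split => // t _ j /=; rewrite finset.in_set0.
have := @partial_sum_setU1_law i (K :\ i) (@finset.set0 I) (fun=> setT) A iK' _ mB0 mA.
rewrite c0 setIT probability_setT mule1 => -> //; first by rewrite finset.in_set0.
move=> B' D mB' mD; apply: IH => //.
  by rewrite (cardsD1 i) iK in Kn.
by apply/fintype.subsetP => j; rewrite !inE orbF => /andP[].
Qed.

(** The product law of the new summand and the old sum is integrated along sections, and the law of
    the summand is then replaced by its density. *)
Lemma partial_sum_convolution i (K : {set I}) (A : set R) (g : R -> R) :
  measurable_fun setT g -> (forall x, 0 <= g x) ->
  (forall D, measurable D ->
    P ((f \o X i) @^-1` D) = (\int[lebesgue_measure]_(x in D) (g x)%:E)%E) ->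
  i \notin K -> measurable A ->
  P (partial_sum (i |: K) @^-1` A) =
  (\int[lebesgue_measure]_y
     (P (partial_sum K @^-1` ((fun x : R => (y + x)%R) @^-1` A)) * (g y)%:E))%E.
Proof.
move=> mg g0 gE iK mA.
have mB0 (j : I) : measurable ((fun=> setT) j : set U) by [].
have c0 : cylinder (@finset.set0 I) (fun=> setT) = setT.
  by apply/seteqP; split => // t _ j /=; rewrite finset.in_set0.
have := @partial_sum_setU1_law i K (@finset.set0 I) (fun=> setT) A iK _ mB0 mA.
rewrite c0 setIT probability_setT mule1 => -> //; first last.
- move=> B' D mB' mD; apply: partial_sum_independent => //.
  apply/fintype.subsetP => j jK; rewrite !inE orbF.
  by apply: contraNN iK => /eqP <-.
- by rewrite finset.in_set0.
rewrite /product_measure1.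
rewrite (@ge0_integral_density _ (measurableTypeR R) R (distribution P (Y i))
  lebesgue_measure g)//.
- apply: eq_integral => y _; congr (P _ * _)%E.
  by apply/seteqP; split => t /=; rewrite /xsection/= inE.
- by apply: measurable_fun_xsection; exact: measurable_sum_pair.
Qed.

End sum_of_independent.

(** * The Erlang distribution and the gamma function *)

(** The Taylor polynomial of exp with [n] terms. For [n = 0] it is 0, which makes [erlang_cdf 0] the
    constant 1, as the empty sum requires for positive thresholds. *)
Definition exp_poly (R : realType) (n : nat) : {poly R} :=
  \poly_(k < n) k`!%:R^-1.

Lemma exp_polyS (R : realType) n (x : R) :
  (exp_poly R n.+1).[x] = (exp_poly R n).[x] + x ^+ n / n`!%:R.
Proof. by rewrite !horner_poly big_ord_recr/= [n`!%:R^-1 * _]mulrC. Qed.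

Lemma exp_poly0 (R : realType) n : (exp_poly R n.+1).[0] = 1.
Proof. by rewrite horner_coef0 coef_poly/= fact0 invr1. Qed.

Lemma deriv_exp_poly (R : realType) n : (exp_poly R n.+1)^`() = exp_poly R n.
Proof.
apply/polyP => i; rewrite coef_deriv !coef_poly ltnS.
case: ifPn => _; last by rewrite mul0rn.
by rewrite factS natrM invfM -[LHS]mulr_natr mulrAC mulVf ?mul1r// pnatr_eq0.
Qed.

(* The probability that a sum of [n] independent standard exponentials is
   less than [x > 0], i.e. that a unit-rate Poisson process has at least [n]
   points before time [x]. *)
Definition erlang_cdf (R : realType) (n : nat) (x : R) : R :=
  1 - expR (- x) * (exp_poly R n).[x].

Lemma is_derive_expRN (R : realType) (x : R) :
  is_derive x 1 (fun t => expR (- t)) (- expR (- x)).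
Proof.
by apply: is_derive_eq; rewrite mulrN1.
Qed.

Lemma continuous_expRN (R : realType) : continuous (fun x : R => expR (- x)).
Proof.
move=> x; apply: differentiable_continuous; apply/derivable1_diffP.
by have [] := is_derive_expRN x.
Qed.

(** Differentiating [exp_poly] drops its top term, so everything cancels except that term. *)
Lemma is_derive_erlang_cdf (R : realType) n (x : R) :
  is_derive x 1 (@erlang_cdf R n.+1) (x ^+ n * expR (- x) / n`!%:R).
Proof.
have := is_derive_expRN x => ?.
rewrite /erlang_cdf; apply: is_derive_eq.
rewrite deriv_exp_poly exp_polyS /GRing.scale/=.
by field; rewrite pnatr_eq0 -lt0n fact_gt0.
Qed.

Lemma integral_itv_is_derive (R : realType) (f F : R -> R) (a b : R) : a < b ->
  (forall x : R, is_derive x 1 F (f x)) -> continuous f ->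
  (\int[lebesgue_measure]_(x in `[a, b]) (f x)%:E = (F b - F a)%:E)%E.
Proof.
move=> ab dF cf.
have cF : continuous F.
  by move=> x; apply/differentiable_continuous/derivable1_diffP; have := dF x => -[].
rewrite (@continuous_FTC2 _ f F)//.
- exact: continuous_subspaceT.
- split.
  + by move=> x _; have := dF x => -[].
  + by apply: cvg_at_right_filter; exact: cF.
  + by apply: cvg_at_left_filter; exact: cF.
- by move=> x _; rewrite derive1E; apply: derive_val.
Qed.

Lemma is_derive_exp_moment (R : realType) n (t : R) :
  is_derive t 1 (fun t => n`!%:R * erlang_cdf n.+1 t) (t ^+ n * expR (- t)).
Proof.
have := is_derive_erlang_cdf n t => ?; apply: is_derive_eq.
by rewrite /GRing.scale/=; field; rewrite pnatr_eq0 -lt0n fact_gt0.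
Qed.

Lemma continuous_exp_moment (R : realType) n :
  continuous (fun t : R => t ^+ n * expR (- t)).
Proof.
by move=> t; apply: cvgM; [exact: exprn_continuous|exact: continuous_expRN].
Qed.

Lemma integral_exp_moment (R : realType) n (x : R) : 0 < x ->
  (\int[lebesgue_measure]_(t in `[0%R, x]) (t ^+ n * expR (- t))%:E =
   (n`!%:R * erlang_cdf n.+1 x)%:E)%E.
Proof.
move=> x0.
rewrite (integral_itv_is_derive x0 (is_derive_exp_moment n)).
  rewrite [in X in _ - X]/erlang_cdf oppr0 expR0 exp_poly0 mulr1 subrr mulr0.
  by rewrite subr0.
exact: continuous_exp_moment.
Qed.

Lemma continuous_erlang_convolution (R : realType) n (c : R) :
  continuous (fun y => erlang_cdf n (c - y) * expR (- y)).
Proof.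
move=> y; apply: differentiable_continuous; apply/derivable1_diffP.
rewrite /erlang_cdf.
have := is_derive_expRN y => ?.
exact: ex_derive.
Qed.

(** The integrand equals e^(-y) - e^(-c) q(c - y) with q the truncated exponential: the factors in y
    cancel in the second term, which leaves a polynomial to integrate. *)
Lemma integral_erlang_convolution (R : realType) n (c : R) : 0 < c ->
  (\int[lebesgue_measure]_(y in `[0%R, c])
     (erlang_cdf n (c - y) * expR (- y))%:E = (erlang_cdf n.+1 c)%:E)%E.
Proof.
move=> c0.
pose F y := - expR (- y) + expR (- c) * (exp_poly R n.+1).[c - y].
have dF (y : R) : is_derive y 1 F (erlang_cdf n (c - y) * expR (- y)).
  have := is_derive_expRN y => ?; apply: is_derive_eq.
  rewrite deriv_exp_poly /GRing.scale/= /erlang_cdf.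
  rewrite opprB mulrBl mul1r mulrAC -expRD addrAC subrr !add0r.
  by ring.
rewrite (integral_itv_is_derive c0 dF).
  rewrite /F subrr exp_poly0 mulr1 addNr oppr0 expR0 addr0 /erlang_cdf.
  by congr EFin; rewrite sub0r opprD opprK.
exact: continuous_erlang_convolution.
Qed.

(** Induction on the size of [K], each step convolving with one exponential. At [c = 0] the formula
    fails for empty [K]: the probability is 0 while [erlang_cdf 0 0] is 1. *)
Lemma partial_sum_erlang d d' (T : measurableType d) (U : measurableType d')
    (R : realType) (P : probability T R) (I : finType) (X : I -> T -> U)
    (f : U -> R) (K : {set I}) (c : R) :
  (forall i, measurable_fun setT (X i)) -> measurable_fun setT f ->
  (forall u, 0 <= f u) -> mutually_independent P X ->
  (forall i (D : set R), measurable D ->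
    P ((f \o X i) @^-1` D) =
    (\int[lebesgue_measure]_(x in D) (exponential_pdf 1 x)%:E)%E) ->
  0 < c -> P (partial_sum X f K @^-1` `]-oo, c[) = (erlang_cdf #|K| c)%:E.
Proof.
move=> mX mf f0 XI fX.
have [n Kn] := ubnP #|K|; elim: n K c Kn => // n IH K c Kn c0.
have [K0|[i iK]] := set_0Vmem K.
  rewrite (_ : _ @^-1` _ = setT).
    by rewrite probability_setT K0 cards0 /erlang_cdf horner_poly big_ord0 mulr0 subr0.
  by apply/seteqP; split => // t _ /=; rewrite in_itv/= /partial_sum K0 big_set0.
have cardK : #|K| = #|K :\ i|.+1 by rewrite (cardsD1 i) iK.
rewrite -[in LHS](finset.setD1K iK).
rewrite (partial_sum_convolution mX mf XI (measurable_exponential_pdf 1)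
  (exponential_pdf_ge0 ler01) (fX i))//; [|by rewrite finset.setD11].
have pre y : (fun x : R => y + x) @^-1` `]-oo, c[ = `]-oo, c - y[%classic.
  by apply/seteqP; split => x /=; rewrite !in_itv/= ltrBrDl.
rewrite cardK -integral_erlang_convolution//.
(* The endpoint [y = c] is removed because the induction hypothesis needs [0 < c - y]. *)
rewrite -integral_itv_bndo_bndc; last first.
  apply: measurable_funTS; apply/measurable_EFinP.
  apply: continuous_measurable_fun.
  exact: continuous_erlang_convolution.
rewrite [RHS]integral_mkcond; apply: eq_integral => y _.
rewrite pre patchE; case: ifPn.
  rewrite inE/= in_itv/= => /andP[y0 yc].
  rewrite IH ?subr_gt0//; last by rewrite -ltnS -cardK.
  by rewrite exponential_pdfE// mul1r mulN1r.
(* Outside [[0, c[] the integrand vanishes: for [y < 0] the density is zero, and for [y >= c] the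
   remaining sum, being nonnegative, cannot lie below [c - y]. *)
rewrite notin_setE/= in_itv/= => /negP; rewrite negb_and -ltNge -leNgt => /orP[y0|cy].
  by rewrite lt0_exponential_pdf// mule0.
rewrite (_ : _ @^-1` _ = set0) ?measure0 ?mul0e//.
apply/seteqP; split => // t /=; rewrite in_itv/= => Stc.
have : partial_sum X f (K :\ i) t < 0 by rewrite (lt_le_trans Stc)// subr_le0.
by rewrite ltNge sumr_ge0.
Qed.

(** Each new top term is at most (n + 1) / x, because x^(n+1) / (n+1)! <= e^x. *)
Lemma cvg_exp_poly_expRN (R : realType) n :
  expR (- x) * (exp_poly R n).[x] @[x --> +oo] --> (0 : R).
Proof.
elim: n => [|n IH].
  rewrite (_ : (fun _ => _) = cst 0); first exact: cvg_cst.
  by apply/funext => x; rewrite horner_poly big_ord0 mulr0.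
rewrite (_ : (fun _ => _) = (fun x => expR (- x) * (exp_poly R n).[x] +
    expR (- x) * (x ^+ n / n`!%:R))); last first.
  by apply/funext => x; rewrite exp_polyS mulrDr.
rewrite -[X in _ --> X]addr0; apply: cvgD => //.
have ub : (n.+1%:R * x^-1) @[x --> +oo] --> (0 : R).
  rewrite -[X in _ --> X](mulr0 n.+1%:R); apply: cvgM; first exact: cvg_cst.
  by apply/gtr0_cvgV0; [exact: nbhs_pinfty_gt|exact: cvg_id].
apply: (squeeze_cvgr _ (cvg_cst 0) ub).
near=> x.
have x0 : 0 < x by near: x; exact: nbhs_pinfty_gt.
rewrite mulr_ge0 ?expR_ge0 ?divr_ge0 ?exprn_ge0 ?(ltW x0)//=.
rewrite expRN ler_pdivrMl ?expR_gt0//.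
have xn1 : x ^+ n.+1 / n.+1`!%:R <= expR x.
  by rewrite (le_trans _ (expR_ge1Dxn n (ltW x0)))// lerDr.
apply: le_trans (ler_wpM2r _ xn1); last by rewrite mulr_ge0// invr_ge0 ltW.
rewrite le_eqVlt; apply/orP; left; apply/eqP.
rewrite factS natrM exprS; field.
by rewrite !gt_eqF// ltr0n fact_gt0.
Unshelve. all: end_near. Qed.

Lemma cvg_erlang_cdf (R : realType) n : @erlang_cdf R n x @[x --> +oo] --> (1 : R).
Proof.
rewrite -[X in _ --> X]subr0; apply: cvgB; first exact: cvg_cst.
exact: cvg_exp_poly_expRN.
Qed.

(** This includes [t = 0], [n = 0], where both powers are 1 by convention. *)
Lemma powR_predn (R : realType) n (t : R) : 0 <= t ->
  t `^ (n.+1%:R - 1) = t ^+ n.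
Proof. by move=> t0; rewrite -natr1 addrK powR_mulrn. Qed.

Lemma lower_gamma_natr (R : realType) n (x : R) : 0 < x ->
  lower_gamma n.+1%:R x = n`!%:R * erlang_cdf n.+1 x.
Proof.
move=> x0; rewrite /lower_gamma /Rintegral.
rewrite (eq_integral
  (fun t : measurableTypeR R => (t ^+ n * expR (- t))%:E)); last first.
  by move=> t /[!inE]/=; rewrite in_itv/= => /andP[t0 _]; rewrite powR_predn.
by rewrite integral_exp_moment.
Qed.

(** The antiderivative [n! * erlang_cdf n.+1] vanishes at 0 and tends to n! at infinity. *)
Lemma Gamma_natr (R : realType) n : Gamma n.+1%:R = n`!%:R :> R.
Proof.
rewrite /Gamma /Rintegral.
rewrite (eq_integral
  (fun t : measurableTypeR R => (t ^+ n * expR (- t))%:E)); last first.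
  by move=> t /[!inE]/=; rewrite in_itv/= andbT => t0; rewrite powR_predn.
pose F (t : R) := n`!%:R * erlang_cdf n.+1 t.
have dF (t : R) : is_derive t 1 F (t ^+ n * expR (- t)).
  exact: is_derive_exp_moment.
have cF : continuous F.
  by move=> x; apply/differentiable_continuous/derivable1_diffP; have := dF x => -[].
rewrite (@ge0_continuous_FTC2y _ (fun t => t ^+ n * expR (- t)) F 0 n`!%:R).
- rewrite /F /erlang_cdf oppr0 expR0 exp_poly0 mulr1 subrr mulr0.
  by rewrite -EFinB subr0.
- by move=> x x0; rewrite mulr_ge0 ?exprn_ge0 ?expR_ge0.
- exact/continuous_subspaceT/continuous_exp_moment.
- rewrite -[X in _ --> X]mulr1; apply: cvgM; first exact: cvg_cst.
  exact: cvg_erlang_cdf.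
- by move=> x _; have := dF x => -[].
- by apply: cvg_at_right_filter; exact: cF.
- by move=> x _; rewrite derive1E; apply: derive_val.
Qed.

(** Multiplied by n!, the Erlang function is the integral of t^n e^(-t) over [0, x]. It is compared
    with the integral of t^n, equal to x^(n+1) / (n+1), and the factorials combine into (n+1)!. *)
Lemma erlang_cdf_bounds (R : realType) n (x : R) : 0 < x ->
  expR (- x) <= erlang_cdf n.+1 x / (x ^+ n.+1 / n.+1`!%:R) <= 1.
Proof.
move=> x0; pose F (t : R) := t ^+ n.+1 / n.+1%:R.
have dF (t : R) : is_derive t 1 F (t ^+ n).
  pose p : {poly R} := n.+1%:R^-1 *: 'X^(n.+1).
  rewrite (_ : F = horner p); last by apply/funext => u; rewrite hornerZ hornerXn mulrC.
  apply: is_derive_eq; rewrite derivZ derivXn hornerZ hornerMn hornerXn.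
  by rewrite -[X in _ * X]mulr_natr mulrCA mulVf ?mulr1// pnatr_eq0.
have mom : (\int[lebesgue_measure]_(t in `[0%R, x]) (t ^+ n)%:E =
    (x ^+ n.+1 / n.+1%:R)%:E)%E.
  rewrite (integral_itv_is_derive x0 dF); last exact: exprn_continuous.
  by rewrite /F expr0n/= mul0r subr0.
have := integral_exp_moment n x0.
have mX k : measurable_fun `[0, x] (fun t : R => (t ^+ k)%:E).
  by apply: measurable_funTS; apply/measurable_EFinP.
have mXE k : measurable_fun `[0, x] (fun t : R => (t ^+ k * expR (- t))%:E).
  apply: measurable_funTS; apply/measurable_EFinP; apply: continuous_measurable_fun.
  exact: continuous_exp_moment.
have ub : (\int[lebesgue_measure]_(t in `[0%R, x]) (t ^+ n * expR (- t))%:E <=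
    \int[lebesgue_measure]_(t in `[0%R, x]) (t ^+ n)%:E)%E.
  apply: ge0_le_integral => //.
  - move=> t /=; rewrite in_itv/= => /andP[t0 _].
    by rewrite lee_fin mulr_ge0 ?exprn_ge0 ?expR_ge0.
  - exact: mXE.
  - exact: mX.
  - move=> t /=; rewrite in_itv/= => /andP[t0 _].
    by rewrite lee_fin ler_piMr ?exprn_ge0// -expR0 ler_expR oppr_le0.
have lb : ((expR (- x))%:E * \int[lebesgue_measure]_(t in `[0%R, x]) (t ^+ n)%:E <=
    \int[lebesgue_measure]_(t in `[0%R, x]) (t ^+ n * expR (- t))%:E)%E.
  rewrite -ge0_integralZl//; last 2 first.
  - exact: mX.
  - by move=> t /=; rewrite in_itv/= => /andP[t0 _]; rewrite lee_fin exprn_ge0.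
  apply: ge0_le_integral => //.
  - move=> t /=; rewrite in_itv/= => /andP[t0 _].
    by rewrite -EFinM lee_fin mulr_ge0 ?exprn_ge0 ?expR_ge0.
  - by apply: measurable_funeM; exact: mX.
  - exact: mXE.
  - move=> t /=; rewrite in_itv/= => /andP[t0 tx].
    by rewrite -EFinM lee_fin mulrC ler_wpM2l ?exprn_ge0// ler_expR lerN2.
move=> E; move: lb ub; rewrite E mom -EFinM !lee_fin.
have n0 : 0 < n.+1%:R :> R by [].
have nf0 : 0 < n`!%:R :> R by rewrite ltr0n fact_gt0.
have xn0 : 0 < x ^+ n.+1 by rewrite exprn_gt0.
move=> lb ub; apply/andP; split.
  rewrite ler_pdivlMr ?divr_gt0 ?ltr0n ?fact_gt0// factS natrM.
  rewrite -(ler_pM2l nf0); apply: le_trans lb; rewrite le_eqVlt; apply/orP; left.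
  by apply/eqP; field; rewrite !gt_eqF.
rewrite ler_pdivrMr ?divr_gt0 ?ltr0n ?fact_gt0// factS natrM.
rewrite -(ler_pM2l nf0); apply: (le_trans ub); rewrite le_eqVlt; apply/orP; left.
by apply/eqP; field; rewrite !gt_eqF.
Qed.

(** * Outage probability *)

Lemma cvec_norm_sqr (R : realType) (M : nat) (v : 'cV[R[i]]_M) :
  cvec_norm v ^+ 2 = \sum_(i < M) sqnorm2 (Re_Im (v i ord0)).
Proof.
rewrite sqr_sqrtr; last by rewrite sumr_ge0// => i _; rewrite sqr_ge0.
apply: eq_bigr => i _; rewrite /sqnorm2 /Re_Im; case: (v i ord0) => x y /=.
by rewrite sqr_sqrtr// addr_ge0 ?sqr_ge0.
Qed.

Lemma powR2_gt1 (R : realType) (r : R) : 0 < r -> 1 < 2 `^ r.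
Proof.
move=> r0; rewrite -ltr_ln ?posrE ?powR_gt0// ln1 ln_powR mulr_gt0// ln_gt0//.
by rewrite ltr1n.
Qed.

Lemma comm_rate_lt (R : realType) (M : nat) (p R0 : R) (v : 'cV[R[i]]_M) :
  0 < p -> (comm_rate p v < R0) = (cvec_norm v ^+ 2 < (2 `^ R0 - 1) / p).
Proof.
move=> p0; rewrite /comm_rate /log2.
have ln2 : 0 < ln 2 :> R by rewrite ln_gt0// ltr1n.
(* Comparing logarithms is legitimate only for positive arguments, here 1 + p |h|^2 and 2^R0. *)
rewrite ltr_pdivrMr// -ln_powR ltr_ln; last 2 first.
- by rewrite posrE ltr_pwDl// mulr_ge0 ?sqr_ge0// ltW.
- by rewrite posrE powR_gt0.
by rewrite ltr_pdivlMr// ltrBrDl [p * _]mulrC.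
Qed.

(** Division by [alpha] turns the summands |h_i|^2 into unit-rate exponentials, and the threshold on
    |h|^2 is divided by [alpha] with them. *)
Lemma outage_prob_erlang d (T : measurableType d) (R : realType)
    (P : probability T R) (M : nat) (alpha R0 p : R) (h : T -> 'cV[R[i]]_M) :
  0 < alpha -> 0 < R0 -> complex_normal_vector P alpha h -> 0 < p ->
  outage_prob P h R0 p = (erlang_cdf M ((2 `^ R0 - 1) / (p * alpha)))%:E.
Proof.
move=> alpha0 R0_gt0 [mX XI lawX] p0.
pose X (i : 'I_M) (t : T) : R * R := Re_Im (h t i ord0).
pose f (z : R * R) := sqnorm2 z / alpha.
have c0 : 0 < (2 `^ R0 - 1) / (p * alpha).
  by rewrite divr_gt0 ?mulr_gt0// subr_gt0 powR2_gt1.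
have mf : measurable_fun setT f.
  by apply: measurable_funM => //; exact: measurable_sqnorm2.
have f0 z : 0 <= f z by rewrite divr_ge0 ?sqnorm2_ge0 ?ltW.
have fX i (D : set R) : measurable D -> P ((f \o X i) @^-1` D) =
    (\int[lebesgue_measure]_(x in D) (exponential_pdf 1 x)%:E)%E.
  move=> mD; rewrite -(complex_normal_prob_sqnorm2 alpha0)// -(lawX i)//.
  by rewrite -[X in measurable X]setTI; exact: mf.
have := partial_sum_erlang [set: 'I_M] mX mf f0 XI fX c0.
rewrite cardsT card_ord => <-; congr (P _).
have sumE t : partial_sum X f [set: 'I_M] t = cvec_norm (h t) ^+ 2 / alpha.
  rewrite cvec_norm_sqr mulr_suml /partial_sum; apply: eq_bigl => i.
  by rewrite finset.in_setT.
by apply/seteqP; split => t /=; rewrite comm_rate_lt// in_itv/= sumE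
  ltr_pdivrMr// invfM mulrA divfK ?gt_eqF.
Qed.

Unset Implicit Arguments.

Theorem theorem2 (d : measure_display) (T : measurableType d) (R : realType)
    (P : probability T R) (M : nat) (alpha R0 : R) (h : T -> 'cV[R[i]]_M)
    (hM : (1 <= M)%N) (halpha : 0 < alpha) (hR0 : 0 < R0)
    (hh : complex_normal_vector P alpha h) :
  (forall p : R, 0 < p ->
    outage_prob P h R0 p =
      ((Gamma M%:R)^-1 *
        lower_gamma M%:R ((2 `^ R0 - 1) / (p * alpha)))%:E) /\
  (fine (outage_prob P h R0 p) /
     ((2 `^ R0 - 1) ^+ M / (p ^+ M * alpha ^+ M * M`!%:R))
    @[p --> +oo] --> (1 : R)).
Proof.
have outE p : 0 < p -> outage_prob P h R0 p =
    (erlang_cdf M ((2 `^ R0 - 1) / (p * alpha)))%:E.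
  exact: outage_prob_erlang.
have a0 : 0 < 2 `^ R0 - 1 :> R by rewrite subr_gt0 powR2_gt1.
(* Writing M = n + 1 turns the exponent M - 1 of the gamma integrands into the natural number
   [n]. *)
case: M hM h hh outE => // n _ h hh outE; split => [p p0|].
  have fact0 : 0 < n`!%:R :> R by rewrite ltr0n fact_gt0.
  rewrite outE// Gamma_natr lower_gamma_natr ?divr_gt0 ?mulr_gt0//.
  by rewrite mulKf// gt_eqF.
pose x p := (2 `^ R0 - 1) / (p * alpha).
have x_cvg0 : x p @[p --> +oo] --> (0 : R).
  rewrite -[X in _ --> X](mulr0 ((2 `^ R0 - 1) / alpha)).
  rewrite (_ : x = fun p => (2 `^ R0 - 1) / alpha * p^-1); last first.
    by apply/funext => p; rewrite /x invfM mulrAC mulrA.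
  apply: cvgM; first exact: cvg_cst.
  by apply/gtr0_cvgV0; [exact: nbhs_pinfty_gt|exact: cvg_id].
have lb : expR (- x p) @[p --> +oo] --> (1 : R).
  rewrite -expR0 -oppr0; apply: continuous_cvg; first exact: continuous_expR.
  exact: cvgN.
apply: (squeeze_cvgr _ lb (cvg_cst (1 : R))).
near=> p.
have p0 : 0 < p by near: p; exact: nbhs_pinfty_gt.
have x0 : 0 < x p by rewrite divr_gt0 ?mulr_gt0.
have := erlang_cdf_bounds n x0; rewrite outE//=.
(* Expanding x^M / M! gives exactly the asymptotic expression of the statement. *)
by rewrite [x p ^+ _]exprMn exprVn exprMn -/(x p) -[_ / _ / _]mulrA -invfM.
Unshelve. all: end_near. Qed.
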